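(* Let $n\ge 1$, let $I$ be a countable partially ordered set, let $\{(X_i,x_i),\varphi_{ij}\}_I$ be an inverse system of pointed topological spaces with pointed continuous bonding maps $\varphi_{ij}:(X_j,x_j)\to(X_i,x_i)$ for $i\le j$, and let $(X,x)=\varprojlim (X_i,x_i)$ be its inverse limit space. Suppose that $X_i$ is second countable and $\pi_n^{qtop}(X_i,x_i)$ is Hausdorff for all $i\in I$, that $\pi_n^{qtop}(X,x)$ is second countable, and that the natural map $\beta_n:\pi_n(X,x)\to\varprojlim\pi_n(X_i,x_i)$ is a group monomorphism. Then $\pi_n^{qtop}(X,x)$ is a topological group.
   Context: For a pointed space $(X,x)$, $\Omega^n(X,x)$ is the $n$th loop space, i.e. the space of continuous maps $([0,1]^n,\partial [0,1]^n)\to (X,x)$ with the compact-open topology. $\pi_n^{qtop}(X,x)$ denotes the homotopy group $\pi_n(X,x)$ endowed with the quotient topology induced by the natural surjection $q:\Omega^n(X,x)\to\pi_n(X,x)$, $f\mapsto [f]$. It is always a quasitopological group (inversion is continuous and multiplication is continuous in each variable separately), but multiplication need not be jointly continuous. The map $\beta_n$ is the homomorphism induced by the projections $(X,x)\to(X_i,x_i)$ of the inverse limit, by functoriality of $\pi_n$; the base point is $x=(x_i)_{i\in I}$. *)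

(* Defs.v *)
From HB Require Import structures.
From mathcomp Require Import all_boot all_order all_algebra generic_quotient.
From mathcomp Require Import all_classical all_reals all_analysis.
From mathcomp Require Import lra.
Import Order.TTheory GRing.Theory Num.Theory.
Import numFieldNormedType.Exports.

Set Implicit Arguments.
Unset Strict Implicit.
Unset Printing Implicit Defensive.

Local Open Scope classical_set_scope.
Local Open Scope ring_scope.

Lemma comp_continuous {T U V : topologicalType} (f : T -> U) (g : U -> V) :
  continuous f -> continuous g -> continuous (fun a => g (f a)).
Proof. by move=> cf cg a; exact: (continuous_comp (cf a) (cg (f a))). Qed.

Lemma pair_continuous {T U V : topologicalType} (f : T -> U) (g : T -> V) :
  continuous f -> continuous g -> continuous (fun a => (f a, g a)).
Proof. by move=> cf cg a; exact: cvg_pair (cf a) (cg a). Qed.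

Lemma fst_continuous {T U V : topologicalType} (f : T -> U * V) :
  continuous f -> continuous (fun a => (f a).1).
Proof.
by move=> cf; apply: (@comp_continuous _ _ _ f fst cf) => a; exact: cvg_fst.
Qed.

Lemma snd_continuous {T U V : topologicalType} (f : T -> U * V) :
  continuous f -> continuous (fun a => (f a).2).
Proof.
by move=> cf; apply: (@comp_continuous _ _ _ f snd cf) => a; exact: cvg_snd.
Qed.

Lemma idfun_continuous {T : topologicalType} : continuous (fun a : T => a).
Proof. by move=> a; exact: cvg_id. Qed.

HB.structure Definition GroupWithTopology := {G of Group G & Topological G}.

Definition is_topological_group (G : GroupWithTopology.type) : Prop :=
  continuous (fun ab : G * G => (ab.1 * ab.2)%g) /\
  continuous (fun a : G => (a^-1)%g).

Definition is_group_monomorphism (G H : groupType) (f : G -> H) : Prop :=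
  {morph f : a b / (a * b)%g} /\ injective f.

Definition unit_interval (R : realType) : Type := set_type (`[0, 1]%classic : set R).
HB.instance Definition _ (R : realType) := Topological.on (unit_interval R).

Definition cube (R : realType) (n : nat) : Type :=
  prod_topology (fun _ : 'I_n => unit_interval R).
HB.instance Definition _ (R : realType) (n : nat) := Topological.on (cube R n).

Section Cube.
Context {R : realType}.
Local Notation I := (unit_interval R).

Definition ui_val (s : I) : R := \val s.

Lemma clamp_subproof (r : R) :
  Num.max 0 (Num.min 1 r) \in (`[0, 1]%classic : set R).
Proof.
by rewrite inE /= in_itv /= le_max lexx /= ge_max ler01 /= ge_min lexx.
Qed.

(* Below, [clamp] only serves to build points of the interval from reals that
   already lie in [0, 1]; it is the identity on those (see [clampE]). *)
Definition clamp (r : R) : I :=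
  exist (fun x => x \in (`[0, 1]%classic : set R)) _ (clamp_subproof r).

Definition cube_boundary {n} (t : cube R n) : Prop :=
  exists j, ui_val (t j) = 0 \/ ui_val (t j) = 1.

Definition set_first {n} (t : cube R n.+1) (s : I) : cube R n.+1 :=
  fun j => if j == ord0 then s else t j.

Lemma ui_ge0 (s : I) : 0 <= ui_val s.
Proof. by have := set_valP s; rewrite /= in_itv /= => /andP[]. Qed.

Lemma ui_le1 (s : I) : ui_val s <= 1.
Proof. by have := set_valP s; rewrite /= in_itv /= => /andP[]. Qed.

Lemma ui_inj (s s' : I) : ui_val s = ui_val s' -> s = s'.
Proof. exact: val_inj. Qed.

Lemma clampE (r : R) : 0 <= r <= 1 -> ui_val (clamp r) = r.
Proof.
by move=> /andP[r0 r1]; rewrite /ui_val /= min_r // max_r.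
Qed.

Lemma clampK (s : I) : clamp (ui_val s) = s.
Proof. by apply: ui_inj; rewrite clampE // ui_ge0 ui_le1. Qed.

Lemma clamp_ge1 (r : R) : 1 <= r -> ui_val (clamp r) = 1.
Proof. by move=> r1; rewrite /ui_val /= min_l // max_r. Qed.

Lemma clamp_le0 (r : R) : r <= 0 -> ui_val (clamp r) = 0.
Proof.
move=> r0; rewrite /ui_val /= min_r ?max_l //.
exact: le_trans r0 ler01.
Qed.

Lemma ui_val_continuous : continuous ui_val.
Proof. exact: initial_continuous. Qed.

Lemma clamp_continuous : continuous clamp.
Proof.
apply: continuous_comp_initial => r.
apply: (@continuous_max R R (cst 0) (fun r : R => Num.min 1 r)); first exact: cvg_cst.
by apply: (@continuous_min R R (cst 1) id); [exact: cvg_cst|exact: cvg_id].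
Qed.

Lemma to_cube_continuous {T : topologicalType} {n} (f : T -> cube R n) :
  (forall j, continuous (fun a => f a j)) -> continuous f.
Proof.
move=> cf a; apply/cvg_sup => j; apply/cvg_image.
  by rewrite eqEsubset; split => // s _; exists (fun=> s).
move=> A /(cf j a) /= fA.
exists ((fun t : cube R n => t j) @^-1` A); first exact: fA.
by rewrite image_preimage // eqEsubset; split => // s _; exists (fun=> s).
Qed.

Lemma coord_continuous {n} (j : 'I_n) : continuous (fun t : cube R n => t j).
Proof. exact: (@proj_continuous _ (fun _ : 'I_n => I) j). Qed.

Lemma set_first_continuous {T : topologicalType} {n}
    (f : T -> cube R n.+1) (g : T -> I) :
  continuous f -> continuous g -> continuous (fun a => set_first (f a) (g a)).
Proof.
move=> cf cg; apply: to_cube_continuous => j; rewrite /set_first.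
case: (j == ord0); first exact: cg.
by move=> a; exact: (continuous_comp (cf a) (@coord_continuous _ j (f a))).
Qed.

Lemma set_first_boundary {n} (t : cube R n.+1) (s : I) :
  ui_val s = 0 \/ ui_val s = 1 -> cube_boundary (set_first t s).
Proof. by move=> s01; exists ord0; rewrite /set_first eqxx. Qed.

Lemma set_firstK {n} (t : cube R n.+1) : set_first t (t ord0) = t.
Proof. by apply/funext => j; rewrite /set_first; case: eqP => // ->. Qed.

Lemma set_first0 {n} (t : cube R n.+1) s : set_first t s ord0 = s.
Proof. by rewrite /set_first eqxx. Qed.

Lemma set_first_set {n} (t : cube R n.+1) s s' :
  set_first (set_first t s) s' = set_first t s'.
Proof. by apply/funext => j; rewrite /set_first; case: eqP. Qed.

Lemma cube_boundaryP {n} (t : cube R n.+1) : cube_boundary t ->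
  (ui_val (t ord0) = 0 \/ ui_val (t ord0) = 1) \/
  (forall s, cube_boundary (set_first t s)).
Proof.
move=> [j tj]; have [j0|j0] := eqVneq j ord0; first by left; rewrite -j0.
by right => s; exists j; rewrite /set_first (negbTE j0).
Qed.

Lemma paste_continuous {T X : topologicalType} (h : T -> R) (u v : T -> X) :
  continuous h -> continuous u -> continuous v ->
  (forall a, h a = 1 / 2 -> u a = v a) ->
  continuous (fun a => if h a <= 1 / 2 then u a else v a).
Proof.
move=> ch cu cv uv; apply/continuous_subspace_setT.
have -> : [set: T] = (h @^-1` [set r | r <= 1 / 2]) `|` (h @^-1` [set r | 1 / 2 <= r]).
  apply/seteqP; split => // a _ /=.
  by case: (leP (h a) (1 / 2)) => [|/ltW]; [left|right].
apply: withinU_continuous.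
- by apply: preimage_closed => //; exact: closed_le.
- by apply: preimage_closed => //; exact: closed_ge.
- apply: (subspace_eq_continuous (f := u)); last exact: continuous_subspaceT.
  by move=> a; rewrite inE /= => ha; rewrite /from_subspace /= ha.
- apply: (subspace_eq_continuous (f := v)); last exact: continuous_subspaceT.
  move=> a; rewrite inE /= => ha; rewrite /from_subspace /=; case: ifP => // ha'.
  by rewrite uv //; apply/eqP; rewrite eq_le ha' ha.
Qed.

Lemma clamp_comp_continuous {T : topologicalType} (h : T -> R) :
  continuous h -> continuous (fun a => clamp (h a)).
Proof. by move=> ch a; exact: (continuous_comp (ch a) (@clamp_continuous (h a))). Qed.

End Cube.

Section Loops.
Context (R : realType) (n : nat) {X : topologicalType} (x : X).

Definition loop_set : set {compact-open, cube R n -> X} :=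
  [set f | continuous (f : cube R n -> X) /\
           forall t : cube R n, cube_boundary t -> f t = x].

(* The topology of a [set_type] is the subspace topology, here the one induced
   by the compact-open topology. *)
Definition loop_space : Type := set_type loop_set.
HB.instance Definition _ := Topological.on loop_space.

Definition loop_fun (f : loop_space) : cube R n -> X := \val f.

Definition mk_loop (f : cube R n -> X) (cf : continuous f)
    (bf : forall t, cube_boundary t -> f t = x) : loop_space :=
  exist (fun f => f \in loop_set) f (mem_set (conj cf bf)).

Lemma loop_continuous (f : loop_space) : continuous (loop_fun f).
Proof. by have [] := set_valP f. Qed.

Lemma loop_boundary (f : loop_space) t : cube_boundary t -> loop_fun f t = x.
Proof. by have [_] := set_valP f; exact. Qed.

Lemma loop_eqP (f g : loop_space) : loop_fun f =1 loop_fun g -> f = g.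
Proof. by move=> fg; apply: val_inj; apply/funext. Qed.

Definition loop_homotopic (f g : loop_space) : Prop :=
  exists H : cube R n * unit_interval R -> X,
    [/\ continuous H,
        forall t, H (t, clamp 0) = loop_fun f t,
        forall t, H (t, clamp 1) = loop_fun g t &
        forall t s, cube_boundary t -> H (t, s) = x].

Lemma loop_homotopic_refl f : loop_homotopic f f.
Proof.
exists (fun ts => loop_fun f ts.1); split => //.
- apply: (@comp_continuous _ _ _ fst (loop_fun f)); last exact: loop_continuous.
  exact: fst_continuous idfun_continuous.
- by move=> t s; exact: loop_boundary.
Qed.

Lemma loop_homotopic_sym f g : loop_homotopic f g -> loop_homotopic g f.
Proof.
move=> [H [cH H0 H1 Hb]].
exists (fun ts => H (ts.1, clamp (1 - ui_val ts.2))); split => /=.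
- apply: (@comp_continuous _ _ _ _ H _ cH); apply: pair_continuous.
    exact: fst_continuous idfun_continuous.
  apply: clamp_comp_continuous => a; apply: cvgB; first exact: cvg_cst.
  apply: (@comp_continuous _ _ _ snd ui_val); last exact: ui_val_continuous.
  exact: snd_continuous idfun_continuous.
- by move=> t; rewrite clamp_le0 // subr0 H1.
- by move=> t; rewrite clamp_ge1 // subrr H0.
- by move=> t s; exact: Hb.
Qed.

Lemma loop_homotopic_trans f g h :
  loop_homotopic f g -> loop_homotopic g h -> loop_homotopic f h.
Proof.
move=> [H [cH H0 H1 Hb]] [K [cK K0 K1 Kb]].
have c2 : continuous (fun ts : cube R n * unit_interval R => ui_val ts.2).
  apply: (@comp_continuous _ _ _ snd ui_val); last exact: ui_val_continuous.
  exact: snd_continuous idfun_continuous.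
exists (fun ts => if ui_val ts.2 <= 1 / 2
  then H (ts.1, clamp (2 * ui_val ts.2))
  else K (ts.1, clamp (2 * ui_val ts.2 - 1))); split => /=.
- apply: (@paste_continuous R _ _ (fun ts => ui_val ts.2)
    (fun ts => H (ts.1, clamp (2 * ui_val ts.2)))
    (fun ts => K (ts.1, clamp (2 * ui_val ts.2 - 1)))) => //.
  + apply: (@comp_continuous _ _ _ _ H _ cH); apply: pair_continuous.
      exact: fst_continuous idfun_continuous.
    apply: clamp_comp_continuous => a.
    by apply: cvgM; [exact: cvg_cst|exact: c2].
  + apply: (@comp_continuous _ _ _ _ K _ cK); apply: pair_continuous.
      exact: fst_continuous idfun_continuous.
    apply: clamp_comp_continuous => a; apply: cvgB; last exact: cvg_cst.
    by apply: cvgM; [exact: cvg_cst|exact: c2].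
  + move=> [t s] /= ->.
    by rewrite mul1r mulfV ?pnatr_eq0 // subrr H1 K0.
- by move=> t; rewrite clamp_le0 // mulr0 divr_ge0 // H0.
- move=> t; rewrite clamp_ge1 // mulr1 ifF; last by apply/negbTE; rewrite -ltNge; lra.
  by rewrite (_ : 2 - 1 = 1 :> R) ?K1 //; lra.
- by move=> t s tb; case: ifP => _; [exact: Hb|exact: Kb].
Qed.

Definition loop_homotopicb (f g : loop_space) : bool := `[< loop_homotopic f g >].

Lemma loop_homotopicb_refl : reflexive loop_homotopicb.
Proof. by move=> f; apply/asboolP; exact: loop_homotopic_refl. Qed.

Lemma loop_homotopicb_sym : symmetric loop_homotopicb.
Proof. by move=> f g; apply/asboolP/asboolP; exact: loop_homotopic_sym. Qed.

Lemma loop_homotopicb_trans : transitive loop_homotopicb.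
Proof.
move=> g f h /asboolP fg /asboolP gh; apply/asboolP.
exact: loop_homotopic_trans fg gh.
Qed.

Canonical loop_homotopy_equiv :=
  EquivRel loop_homotopicb
    loop_homotopicb_refl loop_homotopicb_sym loop_homotopicb_trans.

Local Open Scope quotient_scope.

Definition homotopy_group : Type :=
  quotient_topology {eq_quot loop_homotopy_equiv}.
HB.instance Definition _ := Topological.on homotopy_group.
HB.instance Definition _ := Quotient.on homotopy_group.

Definition homotopy_class (f : loop_space) : homotopy_group :=
  \pi_homotopy_group f.

Lemma homotopy_classP f g :
  homotopy_class f = homotopy_class g <-> loop_homotopic f g.
Proof.
split.
  by move=> /eqmodP /asboolP.
by move=> fg; apply/eqmodP/asboolP.
Qed.

Lemma homotopy_classK (a : homotopy_group) : homotopy_class (repr a) = a.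
Proof. exact: reprK. Qed.

End Loops.

Section LoopOperations.
Context {R : realType} {n : nat} {X : topologicalType} {x : X}.
Local Notation loop := (loop_space R n.+1 x).

(* The usual product of loops, along the first coordinate. *)
Definition concat_fun {Y : Type} (f g : cube R n.+1 -> Y) (t : cube R n.+1) : Y :=
  if ui_val (t ord0) <= 1 / 2 then f (set_first t (clamp (2 * ui_val (t ord0))))
  else g (set_first t (clamp (2 * ui_val (t ord0) - 1))).

Definition reverse_fun {Y : Type} (f : cube R n.+1 -> Y) (t : cube R n.+1) : Y :=
  f (set_first t (clamp (1 - ui_val (t ord0)))).

Lemma first_continuous {T : topologicalType} (p : T -> cube R n.+1) :
  continuous p -> continuous (fun a => ui_val (p a ord0)).
Proof.
move=> cp; apply: (@comp_continuous _ _ _ (fun a => p a ord0) ui_val).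
  apply: (@comp_continuous _ _ _ p (fun t : cube R n.+1 => t ord0) cp).
  exact: coord_continuous.
exact: ui_val_continuous.
Qed.

Lemma reparam_continuous {T : topologicalType} (p : T -> cube R n.+1) (phi : T -> R) :
  continuous p -> continuous phi ->
  continuous (fun a => set_first (p a) (clamp (phi a))).
Proof.
by move=> cp cphi; apply: set_first_continuous => //; exact: clamp_comp_continuous.
Qed.

Lemma double_continuous {T : topologicalType} (phi : T -> R) :
  continuous phi -> continuous (fun a => 2 * phi a).
Proof. by move=> cphi a; apply: cvgM; [exact: cvg_cst|exact: cphi]. Qed.

Lemma double1_continuous {T : topologicalType} (phi : T -> R) :
  continuous phi -> continuous (fun a => 2 * phi a - 1).
Proof.
by move=> cphi a; apply: cvgB; [exact: double_continuous|exact: cvg_cst].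
Qed.

Lemma onem_continuous {T : topologicalType} (phi : T -> R) :
  continuous phi -> continuous (fun a => 1 - phi a).
Proof. by move=> cphi a; apply: cvgB; [exact: cvg_cst|exact: cphi]. Qed.

Lemma concat_fun_boundary (f g : loop) t :
  cube_boundary t -> concat_fun (loop_fun f) (loop_fun g) t = x.
Proof.
rewrite /concat_fun => /cube_boundaryP[[t0|t1]|tb].
- rewrite t0 divr_ge0 // mulr0; apply: loop_boundary; apply: set_first_boundary.
  by left; rewrite clamp_le0.
- rewrite t1 mulr1 ifF; last by apply/negbTE; rewrite -ltNge; lra.
  apply: loop_boundary; apply: set_first_boundary.
  by right; rewrite clamp_ge1 //; lra.
- by case: ifP => _; apply: loop_boundary.
Qed.

Lemma concat_fun_continuous (f g : loop) :
  continuous (concat_fun (loop_fun f) (loop_fun g)).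
Proof.
apply: (@paste_continuous R _ _ (fun t : cube R n.+1 => ui_val (t ord0))
  (fun t => loop_fun f (set_first t (clamp (2 * ui_val (t ord0)))))
  (fun t => loop_fun g (set_first t (clamp (2 * ui_val (t ord0) - 1))))).
- exact: first_continuous idfun_continuous.
- apply: (@comp_continuous _ _ _ _ (loop_fun f)); last exact: loop_continuous.
  apply: reparam_continuous; first exact: idfun_continuous.
  exact: double_continuous (first_continuous idfun_continuous).
- apply: (@comp_continuous _ _ _ _ (loop_fun g)); last exact: loop_continuous.
  apply: reparam_continuous; first exact: idfun_continuous.
  exact: double1_continuous (first_continuous idfun_continuous).
- move=> t ->; rewrite !loop_boundary //; apply: set_first_boundary.
    by left; rewrite clamp_le0 //; lra.
  by right; rewrite clamp_ge1 //; lra.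
Qed.

Definition loop_mul (f g : loop) : loop :=
  mk_loop (@concat_fun_continuous f g) (@concat_fun_boundary f g).

Lemma reverse_fun_boundary (f : loop) t :
  cube_boundary t -> reverse_fun (loop_fun f) t = x.
Proof.
rewrite /reverse_fun => tb; apply: loop_boundary.
case/cube_boundaryP: tb => [[t0|t1]|//]; apply: set_first_boundary.
  by right; rewrite clamp_ge1 // t0 subr0.
by left; rewrite clamp_le0 // t1 subrr.
Qed.

Lemma reverse_fun_continuous (f : loop) : continuous (reverse_fun (loop_fun f)).
Proof.
apply: (@comp_continuous _ _ _ _ (loop_fun f)); last exact: loop_continuous.
apply: reparam_continuous; first exact: idfun_continuous.
exact: onem_continuous (first_continuous idfun_continuous).
Qed.

Definition loop_inv (f : loop) : loop :=
  mk_loop (@reverse_fun_continuous f) (@reverse_fun_boundary f).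

Definition loop_const : loop :=
  mk_loop (@cst_continuous _ _ x) (fun t _ => erefl x).

Lemma concat_funE {Y : Type} (f g : cube R n.+1 -> Y) t r : 0 <= r <= 1 ->
  concat_fun f g (set_first t (clamp r)) =
  if r <= 1 / 2 then f (set_first t (clamp (2 * r)))
  else g (set_first t (clamp (2 * r - 1))).
Proof. by move=> r01; rewrite /concat_fun set_first0 clampE // !set_first_set. Qed.

Lemma reverse_funE {Y : Type} (f : cube R n.+1 -> Y) t r : 0 <= r <= 1 ->
  reverse_fun f (set_first t (clamp r)) = f (set_first t (clamp (1 - r))).
Proof. by move=> r01; rewrite /reverse_fun set_first0 clampE // !set_first_set. Qed.

Lemma loop_mulE (f g : loop) t r : 0 <= r <= 1 ->
  loop_fun (loop_mul f g) (set_first t (clamp r)) =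
  if r <= 1 / 2 then loop_fun f (set_first t (clamp (2 * r)))
  else loop_fun g (set_first t (clamp (2 * r - 1))).
Proof. exact: concat_funE. Qed.

Lemma loop_homotopic_mul (f f' g g' : loop) :
  loop_homotopic f f' -> loop_homotopic g g' ->
  loop_homotopic (loop_mul f g) (loop_mul f' g').
Proof.
move=> [H [cH H0 H1 Hb]] [K [cK K0 K1 Kb]].
exists (fun ts => concat_fun (fun t => H (t, ts.2)) (fun t => K (t, ts.2)) ts.1).
have cfst : continuous (fst : cube R n.+1 * unit_interval R -> _).
  exact: fst_continuous idfun_continuous.
have csnd : continuous (snd : cube R n.+1 * unit_interval R -> _).
  exact: snd_continuous idfun_continuous.
have cf : continuous (fun ts : cube R n.+1 * unit_interval R => ui_val (ts.1 ord0)).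
  exact: first_continuous cfst.
split => /=.
- apply: (@paste_continuous R _ _
    (fun ts : cube R n.+1 * unit_interval R => ui_val (ts.1 ord0))
    (fun ts => H (set_first ts.1 (clamp (2 * ui_val (ts.1 ord0))), ts.2))
    (fun ts => K (set_first ts.1 (clamp (2 * ui_val (ts.1 ord0) - 1)), ts.2))).
  + exact: cf.
  + apply: (@comp_continuous _ _ _ _ H _ cH); apply: pair_continuous => //.
    by apply: reparam_continuous => //; exact: double_continuous.
  + apply: (@comp_continuous _ _ _ _ K _ cK); apply: pair_continuous => //.
    by apply: reparam_continuous => //; exact: double1_continuous.
  + move=> ts ->; rewrite Hb ?Kb //; apply: set_first_boundary.
      by left; rewrite clamp_le0 //; lra.
    by right; rewrite clamp_ge1 //; lra.
- by move=> t; rewrite /loop_fun /= /concat_fun H0 K0.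
- by move=> t; rewrite /loop_fun /= /concat_fun H1 K1.
- move=> t s tb; rewrite /concat_fun; case/cube_boundaryP: tb => [[t0|t1]|tb].
  + rewrite t0 divr_ge0 // mulr0; apply: Hb; apply: set_first_boundary.
    by left; rewrite clamp_le0.
  + rewrite t1 mulr1 ifF; last by apply/negbTE; rewrite -ltNge; lra.
    apply: Kb; apply: set_first_boundary.
    by right; rewrite clamp_ge1 //; lra.
  + by case: ifP => _; [exact: Hb|exact: Kb].
Qed.

Lemma loop_homotopic_inv (f f' : loop) :
  loop_homotopic f f' -> loop_homotopic (loop_inv f) (loop_inv f').
Proof.
move=> [H [cH H0 H1 Hb]].
exists (fun ts => reverse_fun (fun t => H (t, ts.2)) ts.1); split => /=.
- have cfst : continuous (fst : cube R n.+1 * unit_interval R -> _).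
    exact: fst_continuous idfun_continuous.
  apply: (@comp_continuous _ _ _ _ H _ cH); apply: pair_continuous.
    apply: reparam_continuous => //; apply: onem_continuous.
    exact: first_continuous cfst.
  exact: snd_continuous idfun_continuous.
- by move=> t; rewrite /reverse_fun H0.
- by move=> t; rewrite /reverse_fun H1.
- move=> t s tb; apply: Hb.
  case/cube_boundaryP: tb => [[t0|t1]|//]; apply: set_first_boundary.
    by right; rewrite clamp_ge1 // t0 subr0.
  by left; rewrite clamp_le0 // t1 subrr.
Qed.

(* Straight-line homotopy between two reparametrizations of the first
   coordinate that agree at 0 and at 1, with values in {0, 1} there. *)
Lemma loop_homotopic_reparam (f g h : loop) (phi psi : R -> R) :
  continuous phi -> continuous psi ->
  phi 0 = psi 0 -> phi 1 = psi 1 ->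
  (phi 0 = 0 \/ phi 0 = 1) -> (phi 1 = 0 \/ phi 1 = 1) ->
  (forall t (r : R), 0 <= r <= 1 -> loop_fun g (set_first t (clamp r)) =
     loop_fun f (set_first t (clamp (phi r)))) ->
  (forall t (r : R), 0 <= r <= 1 -> loop_fun h (set_first t (clamp r)) =
     loop_fun f (set_first t (clamp (psi r)))) ->
  loop_homotopic g h.
Proof.
move=> cphi cpsi E0 E1 B0 B1 gE hE.
pose line (ts : cube R n.+1 * unit_interval R) :=
  (1 - ui_val ts.2) * phi (ui_val (ts.1 ord0)) +
  ui_val ts.2 * psi (ui_val (ts.1 ord0)).
exists (fun ts => loop_fun f (set_first ts.1 (clamp (line ts)))).
have cfst : continuous (fst : cube R n.+1 * unit_interval R -> _).
  exact: fst_continuous idfun_continuous.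
have cs : continuous (fun ts : cube R n.+1 * unit_interval R => ui_val ts.2).
  apply: (@comp_continuous _ _ _ snd ui_val); last exact: ui_val_continuous.
  exact: snd_continuous idfun_continuous.
have cf : continuous (fun ts : cube R n.+1 * unit_interval R => ui_val (ts.1 ord0)).
  exact: first_continuous cfst.
have t01 (t : cube R n.+1) : 0 <= ui_val (t ord0) <= 1 by rewrite ui_ge0 ui_le1.
split.
- apply: (@comp_continuous _ _ _ _ (loop_fun f)); last exact: loop_continuous.
  apply: reparam_continuous => // ts; apply: cvgD; apply: cvgM.
  + by apply: cvgB; [exact: cvg_cst|exact: cs].
  + exact: (@comp_continuous _ _ _ _ phi cf cphi).
  + exact: cs.
  + exact: (@comp_continuous _ _ _ _ psi cf cpsi).
- move=> t; rewrite /line /= clamp_le0 // subr0 mul1r mul0r addr0.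
  by rewrite -gE ?t01 // clampK set_firstK.
- move=> t; rewrite /line /= clamp_ge1 // subrr mul1r mul0r add0r.
  by rewrite -hE ?t01 // clampK set_firstK.
- move=> t s /cube_boundaryP tb; apply: loop_boundary.
  case: tb => [[|]|//] t0; apply: set_first_boundary; rewrite /line /= t0.
    rewrite -E0 -mulrDl subrK mul1r.
    by case: B0 => ->; [left; rewrite clamp_le0|right; rewrite clamp_ge1].
  rewrite -E1 -mulrDl subrK mul1r.
  by case: B1 => ->; [left; rewrite clamp_le0|right; rewrite clamp_ge1].
Qed.

Lemma loop_mul_const (f : loop) : loop_homotopic (loop_mul f loop_const) f.
Proof.
apply: (@loop_homotopic_reparam f _ _ (fun r => ui_val (clamp (2 * r))) id).
- apply: (@comp_continuous _ _ _ _ ui_val); last exact: ui_val_continuous.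
  exact: clamp_comp_continuous (double_continuous idfun_continuous).
- exact: idfun_continuous.
- by rewrite clamp_le0 // mulr0.
- by rewrite clamp_ge1 //; lra.
- by left; rewrite clamp_le0 // mulr0.
- by right; rewrite clamp_ge1 //; lra.
- move=> t r r01; rewrite /loop_fun /= concat_funE // clampK.
  case: leP => // r2; rewrite [RHS]loop_boundary //.
  by apply: set_first_boundary; right; rewrite clamp_ge1 //; lra.
- by [].
Qed.

Lemma loop_const_mul (f : loop) : loop_homotopic (loop_mul loop_const f) f.
Proof.
apply: (@loop_homotopic_reparam f _ _ (fun r => ui_val (clamp (2 * r - 1))) id).
- apply: (@comp_continuous _ _ _ _ ui_val); last exact: ui_val_continuous.
  exact: clamp_comp_continuous (double1_continuous idfun_continuous).
- exact: idfun_continuous.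
- by rewrite clamp_le0 // mulr0; lra.
- by rewrite clamp_ge1 //; lra.
- by left; rewrite clamp_le0 //; lra.
- by right; rewrite clamp_ge1 //; lra.
- move=> t r r01; rewrite /loop_fun /= concat_funE // clampK.
  case: leP => // r2; rewrite [RHS]loop_boundary //.
  by apply: set_first_boundary; left; rewrite clamp_le0 //; lra.
- by [].
Qed.

Lemma loop_inv_mul (f : loop) :
  loop_homotopic (loop_mul (loop_inv f) f) loop_const.
Proof.
apply: (@loop_homotopic_reparam f _ _
  (fun r => Num.max (1 - 2 * r) (2 * r - 1)) (fun=> 1)).
- move=> r; apply: (@continuous_max R R (fun r : R => 1 - 2 * r) (fun r => 2 * r - 1)).
    exact: (onem_continuous (double_continuous idfun_continuous)).
  exact: (double1_continuous idfun_continuous).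
- exact: cst_continuous.
- by rewrite max_l; lra.
- by rewrite max_r; lra.
- by right; rewrite max_l; lra.
- by right; rewrite max_r; lra.
- move=> t r r01; rewrite [LHS]/loop_fun /= concat_funE //.
  case: leP => r2; first by rewrite /loop_fun /= reverse_funE ?max_l //; lra.
  by rewrite max_r //; lra.
- move=> t r r01; rewrite [RHS]loop_boundary //; apply: set_first_boundary.
  by right; rewrite clamp_ge1.
Qed.

Lemma loop_mul_inv (f : loop) :
  loop_homotopic (loop_mul f (loop_inv f)) loop_const.
Proof.
apply: (@loop_homotopic_reparam f _ _
  (fun r => Num.min (2 * r) (1 - (2 * r - 1))) (fun=> 0)).
- move=> r; apply: (@continuous_min R R (fun r : R => 2 * r) (fun r => 1 - (2 * r - 1))).
    exact: (double_continuous idfun_continuous).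
  exact: (onem_continuous (double1_continuous idfun_continuous)).
- exact: cst_continuous.
- by rewrite min_l; lra.
- by rewrite min_r; lra.
- by left; rewrite min_l; lra.
- by left; rewrite min_r; lra.
- move=> t r r01; rewrite [LHS]/loop_fun /= concat_funE //.
  case: leP => r2; first by rewrite min_l //; lra.
  by rewrite /loop_fun /= reverse_funE ?min_r //; lra.
- move=> t r r01; rewrite [RHS]loop_boundary //; apply: set_first_boundary.
  by left; rewrite clamp_le0.
Qed.

Lemma loop_mulA (f g h : loop) :
  loop_homotopic (loop_mul f (loop_mul g h)) (loop_mul (loop_mul f g) h).
Proof.
apply: loop_homotopic_sym.
apply: (@loop_homotopic_reparam (loop_mul f (loop_mul g h)) _ _
  (fun r => Num.min (2 * r) (Num.min (r + 1 / 4) ((r + 1) / 2))) id).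
- move=> r; apply: (@continuous_min R R (fun r : R => 2 * r)
    (fun r => Num.min (r + 1 / 4) ((r + 1) / 2))).
    exact: (double_continuous idfun_continuous).
  apply: (@continuous_min R R (fun r : R => r + 1 / 4) (fun r => (r + 1) / 2)).
    by apply: cvgD; [exact: cvg_id|exact: cvg_cst].
  apply: cvgM; last exact: cvg_cst.
  by apply: cvgD; [exact: cvg_id|exact: cvg_cst].
- exact: idfun_continuous.
- by rewrite !min_l; lra.
- by rewrite !min_r; lra.
- by left; rewrite !min_l; lra.
- by right; rewrite !min_r; lra.
- move=> t r r01; rewrite loop_mulE //.
  case: (leP r (1 / 2)) => r2.
    rewrite (_ : Num.min (r + 1 / 4) ((r + 1) / 2) = r + 1 / 4); last first.
      by rewrite min_l //; lra.
    rewrite loop_mulE; last by lra.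
    case: (leP (2 * r) (1 / 2)) => r4.
      rewrite min_l; last by lra.
      by rewrite loop_mulE ?r4 //; lra.
    rewrite min_r; last by lra.
    rewrite loop_mulE; last by lra.
    rewrite ifF; last by apply/negbTE; rewrite -ltNge; lra.
    rewrite loop_mulE; last by lra.
    rewrite ifT; last by lra.
    by congr (loop_fun g (set_first t (clamp _))); lra.
  rewrite (_ : Num.min (r + 1 / 4) ((r + 1) / 2) = (r + 1) / 2); last first.
    by rewrite min_r //; lra.
  rewrite min_r; last by lra.
  rewrite loop_mulE; last by lra.
  rewrite ifF; last by apply/negbTE; rewrite -ltNge; lra.
  rewrite loop_mulE; last by lra.
  rewrite ifF; last by apply/negbTE; rewrite -ltNge; lra.
  by congr (loop_fun h (set_first t (clamp _))); lra.
- by [].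
Qed.

End LoopOperations.

Section HomotopyGroup.
Context {R : realType} {n : nat} {X : topologicalType} {x : X}.
Local Notation loop := (loop_space R n.+1 x).
Local Notation piX := (homotopy_group R n.+1 x).

Lemma homotopic_repr (f : loop) : loop_homotopic (repr (homotopy_class f)) f.
Proof. by apply/homotopy_classP; rewrite homotopy_classK. Qed.

(* [repr] picks a representative; [pi_mulE] and [pi_invE] show that the choice
   is irrelevant. *)
Definition pi_mul (a b : piX) : piX := homotopy_class (loop_mul (repr a) (repr b)).
Definition pi_inv (a : piX) : piX := homotopy_class (loop_inv (repr a)).
Definition pi_one : piX := homotopy_class loop_const.

Lemma pi_mulE (f g : loop) :
  pi_mul (homotopy_class f) (homotopy_class g) = homotopy_class (loop_mul f g).
Proof. by apply/homotopy_classP; apply: loop_homotopic_mul; exact: homotopic_repr. Qed.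

Lemma pi_invE (f : loop) :
  pi_inv (homotopy_class f) = homotopy_class (loop_inv f).
Proof. by apply/homotopy_classP; apply: loop_homotopic_inv; exact: homotopic_repr. Qed.

Lemma pi_mulA : associative pi_mul.
Proof.
move=> a b c; rewrite -(homotopy_classK a) -(homotopy_classK b) -(homotopy_classK c).
by rewrite !pi_mulE; apply/homotopy_classP; exact: loop_mulA.
Qed.

Lemma pi_1mul : left_id pi_one pi_mul.
Proof.
move=> a; rewrite -(homotopy_classK a) pi_mulE.
by apply/homotopy_classP; exact: loop_const_mul.
Qed.

Lemma pi_mul1 : right_id pi_one pi_mul.
Proof.
move=> a; rewrite -(homotopy_classK a) pi_mulE.
by apply/homotopy_classP; exact: loop_mul_const.
Qed.

Lemma pi_Vmul : left_inverse pi_one pi_inv pi_mul.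
Proof.
move=> a; rewrite -(homotopy_classK a) pi_invE pi_mulE.
by apply/homotopy_classP; exact: loop_inv_mul.
Qed.

Lemma pi_mulV : right_inverse pi_one pi_inv pi_mul.
Proof.
move=> a; rewrite -(homotopy_classK a) pi_invE pi_mulE.
by apply/homotopy_classP; exact: loop_mul_inv.
Qed.

HB.instance Definition _ :=
  isGroup.Build piX pi_mulA pi_1mul pi_mul1 pi_Vmul pi_mulV.

Lemma homotopy_classM (f g : loop) :
  homotopy_class (loop_mul f g) = (homotopy_class f * homotopy_class g)%g :> piX.
Proof. by rewrite -pi_mulE. Qed.

End HomotopyGroup.

Record pointed_map {X Y : topologicalType} (x : X) (y : Y) := PointedMap {
  pointed_map_fun :> X -> Y;
  pointed_map_continuous : continuous pointed_map_fun;
  pointed_map_point : pointed_map_fun x = y }.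

Section Functoriality.
Context {R : realType} {n : nat}.

Section InducedMap.
Context {X Y : topologicalType} {x : X} {y : Y} (h : pointed_map x y).

Lemma loop_map_continuous (f : loop_space R n x) :
  continuous (fun t => h (loop_fun f t)).
Proof.
apply: (@comp_continuous _ _ _ (loop_fun f) h); first exact: loop_continuous.
exact: pointed_map_continuous.
Qed.

Lemma loop_map_boundary (f : loop_space R n x) t :
  cube_boundary t -> h (loop_fun f t) = y.
Proof. by move=> tb; rewrite loop_boundary // pointed_map_point. Qed.

Definition loop_map (f : loop_space R n x) : loop_space R n y :=
  mk_loop (@loop_map_continuous f) (@loop_map_boundary f).

Lemma loop_homotopic_map f g :
  loop_homotopic f g -> loop_homotopic (loop_map f) (loop_map g).
Proof.
move=> [H [cH H0 H1 Hb]]; exists (fun ts => h (H ts)); split.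
- exact: (@comp_continuous _ _ _ H h cH (@pointed_map_continuous _ _ _ _ h)).
- by move=> t; rewrite H0.
- by move=> t; rewrite H1.
- by move=> t s tb; rewrite Hb // pointed_map_point.
Qed.

Definition pi_map (a : homotopy_group R n x) : homotopy_group R n y :=
  homotopy_class (loop_map (repr a)).

Lemma pi_mapE f : pi_map (homotopy_class f) = homotopy_class (loop_map f).
Proof.
apply/homotopy_classP/loop_homotopic_map/homotopy_classP.
exact: homotopy_classK.
Qed.

End InducedMap.

Lemma pi_map_id {X : topologicalType} {x : X} (h : pointed_map x x) :
  (forall u, h u = u) -> forall a, pi_map h a = a.
Proof.
move=> hid a; rewrite -(homotopy_classK a) pi_mapE.
by congr (homotopy_class _); apply: loop_eqP => t; exact: hid.
Qed.

Lemma pi_map_comp {X Y Z : topologicalType} {x : X} {y : Y} {z : Z}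
    (h : pointed_map x y) (k : pointed_map y z) (l : pointed_map x z) :
  (forall u, k (h u) = l u) -> forall a, pi_map k (pi_map h a) = pi_map l a.
Proof.
move=> hkl a; rewrite -(homotopy_classK a) !pi_mapE.
by congr (homotopy_class _); apply: loop_eqP => t; exact: hkl.
Qed.

End Functoriality.

Section InducedMorphism.
Context {R : realType} {n : nat}.
Context {X Y : topologicalType} {x : X} {y : Y} (h : pointed_map x y).
Local Notation piX := (homotopy_group R n.+1 x).
Local Notation piY := (homotopy_group R n.+1 y).

Lemma pi_mapM : {morph (pi_map h : piX -> piY) : a b / (a * b)%g}.
Proof.
move=> a b; rewrite -(homotopy_classK a) -(homotopy_classK b).
rewrite -homotopy_classM !pi_mapE -homotopy_classM.
congr (homotopy_class _); apply: loop_eqP => t.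
exact: (fun_if h).
Qed.

End InducedMorphism.

Definition compatible {d} {I : porderType d} {T : I -> Type}
    (phi : forall i j, (i <= j)%O -> T j -> T i) (u : forall i, T i) : Prop :=
  forall i j (ij : (i <= j)%O), phi i j ij (u j) = u i.

Record pointed_inverse_system {d} (I : porderType d) := PointedInverseSystem {
  system_space : I -> topologicalType;
  system_point : forall i, system_space i;
  bonding : forall i j, (i <= j)%O ->
    pointed_map (system_point j) (system_point i);
  bonding_id : forall i (ii : (i <= i)%O) u, bonding ii u = u;
  bonding_comp : forall i j k (ij : (i <= j)%O) (jk : (j <= k)%O)
    (ik : (i <= k)%O) u, bonding ij (bonding jk u) = bonding ik u }.

Arguments bonding {d I} S {i j} ij : rename.

Section SpaceLimit.
Context {d} {I : porderType d} (S : pointed_inverse_system I).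

Definition space_limit_set : set (prod_topology (system_space S)) :=
  [set u | compatible (fun i j ij => bonding S ij) u].

Definition space_limit : topologicalType := set_type space_limit_set.

Lemma limit_base_subproof : space_limit_set (system_point S).
Proof. by move=> i j ij; exact: pointed_map_point. Qed.

Definition limit_base : space_limit :=
  exist (fun u => u \in space_limit_set) (system_point S)
    (mem_set limit_base_subproof).

Lemma projection_continuous i : continuous (fun u : space_limit => \val u i).
Proof.
apply: (@comp_continuous _ (prod_topology (system_space S)) _ (fun u : space_limit => \val u)
  (fun v => v i)).
  exact: initial_continuous.
exact: proj_continuous.
Qed.

Definition projection i : pointed_map limit_base (system_point S i) :=
  PointedMap (@projection_continuous i) erefl.

End SpaceLimit.

Record group_inverse_system {d} (I : porderType d) := GroupInverseSystem {
  system_group : I -> groupType;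
  group_bonding : forall i j, (i <= j)%O -> system_group j -> system_group i;
  group_bondingM : forall i j (ij : (i <= j)%O),
    {morph group_bonding ij : a b / (a * b)%g};
  group_bonding_id : forall i (ii : (i <= i)%O) a, group_bonding ii a = a;
  group_bonding_comp : forall i j k (ij : (i <= j)%O) (jk : (j <= k)%O)
    (ik : (i <= k)%O) a,
    group_bonding ij (group_bonding jk a) = group_bonding ik a }.

Arguments group_bonding {d I} G {i j} ij a : rename.

Section GroupLimit.
Context {d} {I : porderType d} (G : group_inverse_system I).

Definition group_limit_set : set (forall i, system_group G i) :=
  [set a | compatible (fun i j ij => group_bonding G ij) a].

Definition group_limit : Type := set_type group_limit_set.
HB.instance Definition _ := Choice.on group_limit.

Definition mk_limit (a : forall i, system_group G i)
    (ca : compatible (fun i j ij => group_bonding G ij) a) : group_limit :=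
  exist (fun a => a \in group_limit_set) a (mem_set ca).

Lemma limit_compatible (a : group_limit) :
  compatible (fun i j ij => group_bonding G ij) (\val a).
Proof. exact: set_valP a. Qed.

Lemma limit_mul_subproof (a b : group_limit) :
  compatible (fun i j ij => group_bonding G ij) (fun i => \val a i * \val b i)%g.
Proof. by move=> i j ij; rewrite group_bondingM !limit_compatible. Qed.

Lemma limit_one_subproof :
  compatible (fun i j ij => group_bonding G ij) (fun i => 1%g : system_group G i).
Proof. move=> i j ij; apply: (mulgI (group_bonding G ij 1%g)).
by rewrite -group_bondingM !mulg1. Qed.

Lemma limit_inv_subproof (a : group_limit) :
  compatible (fun i j ij => group_bonding G ij) (fun i => (\val a i)^-1)%g.
Proof. move=> i j ij; apply: (mulgI (\val a i)).
rewrite -{1}(limit_compatible a ij) -group_bondingM !mulgV.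
exact: limit_one_subproof. Qed.

Definition limit_mul a b := mk_limit (limit_mul_subproof a b).
Definition limit_one := mk_limit limit_one_subproof.
Definition limit_inv a := mk_limit (limit_inv_subproof a).

Lemma limit_eqP (a b : group_limit) : (forall i, \val a i = \val b i) -> a = b.
Proof. by move=> ab; apply: val_inj; exact: functional_extensionality_dep. Qed.

Lemma limit_mulA : associative limit_mul.
Proof. by move=> a b c; apply: limit_eqP => i /=; exact: mulgA. Qed.

Lemma limit_1mul : left_id limit_one limit_mul.
Proof. by move=> a; apply: limit_eqP => i /=; exact: mul1g. Qed.

Lemma limit_mul1 : right_id limit_one limit_mul.
Proof. by move=> a; apply: limit_eqP => i /=; exact: mulg1. Qed.

Lemma limit_Vmul : left_inverse limit_one limit_inv limit_mul.
Proof. by move=> a; apply: limit_eqP => i /=; exact: mulVg. Qed.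

Lemma limit_mulV : right_inverse limit_one limit_inv limit_mul.
Proof. by move=> a; apply: limit_eqP => i /=; exact: mulgV. Qed.

HB.instance Definition _ := isGroup.Build group_limit
  limit_mulA limit_1mul limit_mul1 limit_Vmul limit_mulV.

End GroupLimit.

Section Beta.
Context (R : realType) (n : nat) {d} {I : porderType d}.
Context (S : pointed_inverse_system I).

Definition pi_system : group_inverse_system I :=
  @GroupInverseSystem d I
    (fun i => homotopy_group R n.+1 (system_point S i))
    (fun i j ij => pi_map (bonding S ij))
    (fun i j ij => pi_mapM (bonding S ij))
    (fun i ii => pi_map_id (@bonding_id _ _ S i ii))
    (fun i j k ij jk ik => pi_map_comp (@bonding_comp _ _ S i j k ij jk ik)).

Lemma beta_subproof (a : homotopy_group R n.+1 (limit_base S)) :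
  compatible (fun i j ij => group_bonding pi_system ij)
    (fun i => pi_map (projection S i) a).
Proof.
move=> i j ij; apply: pi_map_comp => u.
exact: (set_valP u).
Qed.

Definition beta (a : homotopy_group R n.+1 (limit_base S)) :
  group_limit pi_system := mk_limit (beta_subproof a).

Lemma betaM : {morph beta : a b / (a * b)%g}.
Proof. by move=> a b; apply: limit_eqP => i /=; exact: pi_mapM. Qed.

End Beta.

Arguments beta R n {d I} S a.

(* Main.v *)
Require Import Defs.
From mathcomp Require Import all_boot all_order all_algebra.
From mathcomp Require Import all_classical all_reals all_analysis.
From mathcomp Require Import lra.
Import Order.TTheory GRing.Theory Num.Theory.
Import numFieldNormedType.Exports.

(** The multiplication of the homotopy group is induced by concatenation of
    loops, which is continuous on the loop space ([continuous_loop_mul]).  If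
    the square of the quotient map from loops to homotopy classes were again a
    quotient map, continuity of the multiplication would follow at once.  A
    product of quotient maps is not a quotient map in general; this is the only
    obstacle, and the countability and separation hypotheses remove it.

    The key is that convergent sequences lift along a quotient map [q : T -> Y]
    when [T] is second countable and [Y] is Hausdorff
    ([quotient_map_lift]).  Suppose [y k] tends to [a] without ever taking the
    value [a].  Then the set of the [y k] is not closed, so its preimage in [T]
    is not closed either, and some sequence of that preimage converges to a
    point outside of it.  The image of this sequence runs through terms of [y]
    with indices tending to infinity, so that by uniqueness of limits its limit
    lies over [a].  When [Y] is second countable too, sequences detect the open
    subsets of [Y * Y]; lifting first the one coordinate and then the other
    gives that [q * q] is a quotient map ([quotient_map_prod]).

    It remains to see that these hypotheses hold for the loops of the limit.
    The limit is a subspace of a countable product of second countable spaces,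
    hence second countable, and the compact-open topology on maps from the cube
    inherits this ([second_countable_compact_open]): it is enough to test the
    closures of the members of a countable basis of the cube against the
    members of a countable basis of the target.  The homotopy group of the limit
    is Hausdorff because injectivity of [beta] says that the continuous maps
    induced by the projections separate its points. *)

Set Implicit Arguments.
Unset Strict Implicit.
Unset Printing Implicit Defensive.

Local Open Scope classical_set_scope.
Local Open Scope ring_scope.

(** * Second countable spaces *)

(** A countable family of open sets is a subbase as soon as it controls the
    convergence of filters; the basis consists of its finite intersections.
    Testing convergence instead of open sets avoids any description of the
    open sets of product, subspace and compact-open topologies below. *)
Lemma second_countable_subbase {T : topologicalType} (S : set (set T)) :
  countable S -> S `<=` open ->
  (forall (F : set_system T) (x : T), Filter F ->
    (forall V, S V -> V x -> F V) -> F --> x) ->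
  @second_countable T.
Proof.
move=> Sc So Scvg; exists (finI_from S id); first exact: finI_from_countable.
split=> [_ [D DS <-]|x].
  rewrite openE => x xD; apply: filter_bigI => V VD.
  by apply: open_nbhs_nbhs; split; [apply/So/set_mem/DS|exact: xD].
apply: Scvg.
  apply: filter_from_filter.
    have : (\bigcup_(U in finI_from S id) U) x by rewrite finI_from_cover.
    by move=> [U US Ux]; exists U.
  move=> U V [US Ux] [VS Vx]; exists (U `&` V) => //; split=> //.
  exact: finI_fromI.
by move=> V SV Vx; exists V => //; split=> //; exact: finI_from1.
Qed.

(** The form in which the previous lemma is used for subspaces and countable
    products: the topology is the coarsest one making all the [f i]
    continuous, as expressed by the last hypothesis. *)
Lemma second_countable_initial {T : topologicalType} {I : Type}
    {X : I -> topologicalType} (f : forall i, T -> X i) :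
  countable [set: I] -> (forall i, @second_countable (X i)) ->
  (forall i, continuous (f i)) ->
  (forall (F : set_system T) (x : T), Filter F ->
    (forall i, f i @ F --> f i x) -> F --> x) ->
  @second_countable T.
Proof.
move=> Ic Xc fc Fcvg.
pose B i := s2val (cid2 (Xc i)).
have Bc i : countable (B i) := s2valP (cid2 (Xc i)).
have [Bo Bb] : (forall i, B i `<=` open) /\
    forall i (x : X i), filter_from [set U | B i U /\ U x] id --> x.
  by split=> i; have [] := s2valP' (cid2 (Xc i)).
apply: (@second_countable_subbase _ (\bigcup_i [set f i @^-1` V | V in B i])).
- apply: bigcup_countable => // i _; apply: card_le_trans (card_image_le _ _) _.
  exact: Bc.
- move=> _ [i _ [V BV <-]]; apply: open_comp => [x _|]; first exact: fc.
  exact: Bo BV.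
- move=> F x FF SF; apply: Fcvg => i V /(Bb i (f i x)) [U [BU Ux] UV].
  by apply: filterS (SF (f i @^-1` U) _ Ux); [move=> y /UV|exists i => //; exists U].
Qed.

Lemma cvg_initial {T : choiceType} {U : topologicalType} (f : T -> U)
    (F : set_system T) (x : T) : Filter F ->
  f @ F --> f x -> F --> (x : initial_topology f).
Proof.
move=> FF fF A [_ [[B Bo <-] Bx] BA]; apply: (filterS BA).
exact: fF (open_nbhs_nbhs (conj Bo Bx)).
Qed.

Lemma cvg_prod_topology {I : Type} {X : I -> topologicalType}
    (F : set_system (prod_topology X)) (u : prod_topology X) : Filter F ->
  (forall i, (fun v : prod_topology X => v i) @ F --> u i) -> F --> u.
Proof. by move=> FF cF; apply/cvg_sup => i; exact: cvg_initial. Qed.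

Lemma second_countable_prod {I : eqType} {X : I -> topologicalType} :
  countable [set: I] -> (forall i, @second_countable (X i)) ->
  @second_countable (prod_topology X).
Proof.
move=> Ic Xc; apply: (@second_countable_initial (prod_topology X) I X (fun i v => v i)) => //.
  by move=> i; exact: proj_continuous.
exact: @cvg_prod_topology.
Qed.

Lemma second_countable_set_type {X : topologicalType} (A : set X) :
  @second_countable X -> @second_countable (set_type A).
Proof.
move=> Xc; apply: (@second_countable_initial (set_type A) unit (fun=> X) (fun=> \val)) => //.
  by move=> _; exact: initial_continuous.
by move=> F x FF Fx; exact: cvg_initial (Fx tt).
Qed.

Lemma second_countable_real (R : realType) : @second_countable R.
Proof.
exists (range (fun cr : rat * rat => ball (ratr cr.1 : R) (ratr cr.2))).
  exact: card_le_trans (card_image_le _ _) (countableP _).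
split=> [_ [cr _ <-]|x V]; first exact: ball_open.
rewrite nbhsE => -[U [Uo Ux] UV].
have [c [r [/set_mem xB BU]]] := open_subball_rat Uo (mem_set Ux).
by exists (ball (ratr c : R) (ratr r)); [split=> //; exists (c, r)|exact: subset_trans UV].
Qed.

(** First countability, packaged for building convergent sequences: choosing
    one point in each [V k] is enough.  The [V k] are the decreasing
    intersections of an enumeration of the basic neighbourhoods of [x]. *)
Lemma countable_approach {T : topologicalType} (x : T) :
  @second_countable T -> exists V : nat -> set T,
    (forall k, nbhs x (V k)) /\
    (forall u : nat -> T, (forall k, V k (u k)) -> u @ \oo --> x).
Proof.
move=> [B Bc [Bo Bx]].
have : countable [set U | B U /\ U x].
  by apply: sub_countable Bc; apply: subset_card_le => U [].
move=> /pfcard_geP[B0|/unsquash b].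
  have [U BU _] := Bx x setT filterT.
  by move: BU; rewrite B0.
have bP k : B (b k) /\ b k x by have := @funS _ _ _ _ b k I.
pose V := fix V k := if k is j.+1 then b k `&` V j else b k.
have V_nbhs k : nbhs x (V k).
  have bx j : nbhs x (b j) by have [/Bo bo bx] := bP j; exact: open_nbhs_nbhs.
  by elim: k => [|k IH] /=; [exact: bx|exact: filterI].
have V_sub k j : (j <= k)%N -> V k `<=` b j.
  elim: k => [|k IH]; first by rewrite leqn0 => /eqP ->.
  rewrite leq_eqVlt => /predU1P[->|jk] y [by_k Vky] //; exact: IH.
exists V; split=> // u Vu A /Bx [U [BU Ux] UA].
have [j _ bj] := @surj _ _ _ _ b U (conj BU Ux).
by exists j => // k /= jk; apply: UA; rewrite -bj; exact: V_sub (Vu k).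
Qed.

Lemma closure_sequence {T : topologicalType} (A : set T) (x : T) :
  @second_countable T -> closure A x ->
  exists2 u : nat -> T, forall k, A (u k) & u @ \oo --> x.
Proof.
move=> /(countable_approach x)[V [Vx Vcvg]] Ax.
have /boolp.choice[u u_] : forall k, exists y, A y /\ V k y by move=> k; exact: Ax (Vx k).
by exists u => [k|]; [exact: (u_ k).1|apply: Vcvg => k; exact: (u_ k).2].
Qed.

Lemma hausdorff_continuous_inj {X : topologicalType} {I : Type} {Y : I -> topologicalType}
    (f : forall i, X -> Y i) :
  (forall i, hausdorff_space (Y i)) -> (forall i, continuous (f i)) ->
  (forall a b, (forall i, f i a = f i b) -> a = b) -> hausdorff_space X.
Proof.
move=> Yh fc finj a b ab; apply: finj => i; apply: Yh => U V Ua Vb.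
have [c [Uc Vc]] := ab _ _ (fc i a U Ua) (fc i b V Vb).
by exists (f i c).
Qed.

(** * Products of quotient maps *)

Definition quotient_map {T Y : topologicalType} (q : T -> Y) : Prop :=
  (forall y, exists f, q f = y) /\ forall U, open U <-> open (q @^-1` U).

Lemma quotient_map_continuous {T Y : topologicalType} (q : T -> Y) :
  quotient_map q -> continuous q.
Proof. by move=> [_ qo]; apply/continuousP => U /qo. Qed.

Lemma quotient_map_factor {T Y Z : topologicalType} (q : T -> Y) (g : Y -> Z) :
  quotient_map q -> continuous (g \o q) -> continuous g.
Proof.
by move=> [_ qo] /continuousP gq; apply/continuousP => U Uo; apply/qo; exact: gq.
Qed.

(** Lifting of convergent sequences, after passing to the terms of index
    [k m].  The indices [k m] need not increase: tending to infinity is all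
    that is needed to reindex a limit. *)
Lemma quotient_map_lift {T Y : topologicalType} (q : T -> Y) (y : nat -> Y) (a : Y) :
  quotient_map q -> @second_countable T -> hausdorff_space Y -> y @ \oo --> a ->
  exists (k : nat -> nat) (f : nat -> T) (f0 : T),
    [/\ k @ \oo --> \oo, f @ \oo --> f0, q f0 = a & forall m, q (f m) = y (k m)].
Proof.
move=> qq Tc Yh ya; have [qs qo] := qq; have [f0 qf0] := qs a.
(* If the value a is taken infinitely often, constant lifts do. *)
have [often|] := pselect (forall m, exists k, (m <= k)%N /\ y k = a).
  have [k k_] := boolp.choice often.
  exists k, (fun=> f0), f0; split=> //; last by move=> m; rewrite (k_ m).2.
    move=> A [N _ NA]; exists N => // m /= Nm; apply: NA => /=.
    exact: leq_trans Nm (k_ m).1.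
  exact: cvg_cst.
move=> /existsNP[N never].
have {}never k : (N <= k)%N -> y k <> a by move=> Nk yk; apply: never; exists k.
pose A := [set y k | k in [set k | (N <= k)%N]].
have Aa : closure A a.
  move=> U /ya [M _ MU]; exists (y (maxn N M)); split.
    by exists (maxn N M) => //=; exact: leq_maxl.
  by apply: MU => /=; exact: leq_maxr.
have [f0' [Af0 nAf0]] : exists g, closure (q @^-1` A) g /\ ~ A (q g).
  apply: contrapT => /forallNP qAcl.
  have : closed A.
    rewrite -[A]setCK; apply: open_closedC; apply/qo.
    rewrite preimage_setC; apply: closed_openC => g Ag.
    by apply: contrapT => nAg; apply: (qAcl g).
  by move=> /(_ a Aa) [k /= Nk]; exact: never.
have [f fA ff0] := closure_sequence Tc Af0.
have /boolp.choice[k k_] : forall m, exists k, (N <= k)%N /\ y k = q (f m).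
  by move=> m; have [k Nk yk] := fA m; exists k.
have qf : (fun m => q (f m)) @ \oo --> q f0'.
  by apply: cvg_comp ff0 _; exact: quotient_map_continuous.
(* Each term y M with M >= N lies in A, hence differs from q f0' and, points
   being closed, is avoided by q (f m) for large m. *)
have koo : k @ \oo --> \oo.
  apply/cvgnyPge; elim=> [|M IH]; first exact: nearW.
  have kM : \forall m \near \oo, k m <> M.
    have [NM|MN] := leqP N M; last first.
      by apply: nearW => m kM; move: (k_ m).1; rewrite kM leqNgt MN.
    have qf_neq : \forall m \near \oo, q (f m) <> y M.
      apply: (qf (~` [set y M])); apply: open_nbhs_nbhs; split.
        exact/closed_openC/accessible_closed_set1/hausdorff_accessible.
      by move=> /= qM; apply: nAf0; exists M.
    by apply: filterS qf_neq => m + kM; rewrite -(k_ m).2 kM.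
  by apply: filterS2 IH kM => m /= Mk /eqP; rewrite ltn_neqAle eq_sym Mk andbT.
exists k, f, f0'; split=> //; last by move=> m; rewrite (k_ m).2.
have yk : (fun m => y (k m)) @ \oo --> a by apply: cvg_comp koo ya.
apply: (cvg_unique Yh qf); suff -> : (fun m => q (f m)) = (fun m => y (k m)) by [].
by apply/funext => m /=; rewrite (k_ m).2.
Qed.

(** If [W] were not open at [(a, b)], some sequence outside [W] would converge
    to [(a, b)].  Its first coordinate lifts along a reindexing, and the second
    coordinate then lifts along a further one; the lifted pairs converge to a
    point of the open preimage of [W], so they enter it. *)
Lemma quotient_map_prod {T1 T2 Y1 Y2 : topologicalType} (q1 : T1 -> Y1) (q2 : T2 -> Y2)
    (W : set (Y1 * Y2)) :
  quotient_map q1 -> quotient_map q2 ->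
  @second_countable T1 -> @second_countable T2 ->
  @second_countable Y1 -> @second_countable Y2 ->
  hausdorff_space Y1 -> hausdorff_space Y2 ->
  open [set f : T1 * T2 | W (q1 f.1, q2 f.2)] -> open W.
Proof.
move=> qq1 qq2 T1c T2c Y1c Y2c Y1h Y2h Wo.
rewrite openE => -[a b] Wab; apply: contrapT => nW.
have [U [Ua Ucvg]] := countable_approach a Y1c.
have [V [Vb Vcvg]] := countable_approach b Y2c.
have /boolp.choice[p p_] : forall m, exists p, [/\ U m p.1, V m p.2 & ~ W p].
  move=> m; apply: contrapT => /forallNP UVW; apply: nW.
  exists (U m, V m) => [|p [Up Vp]]; first by split; [exact: Ua|exact: Vb].
  by apply: contrapT => nWp; apply: (UVW p).
have p1 : (fun m => (p m).1) @ \oo --> a by apply: Ucvg => m; case: (p_ m).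
have p2 : (fun m => (p m).2) @ \oo --> b by apply: Vcvg => m; case: (p_ m).
have [k [f [f0 [koo ff0 qf0 qf]]]] := quotient_map_lift qq1 T1c Y1h p1.
have p2k : (fun m => (p (k m)).2) @ \oo --> b by apply: cvg_comp koo p2.
have [l [g [g0 [loo gg0 qg0 qg]]]] := quotient_map_lift qq2 T2c Y2h p2k.
have fl : (fun m => f (l m)) @ \oo --> f0 by apply: cvg_comp loo ff0.
have : nbhs (f0, g0) [set f : T1 * T2 | W (q1 f.1, q2 f.2)].
  by apply: open_nbhs_nbhs; split=> //=; rewrite qf0 qg0.
move=> /(cvg_pair fl gg0) [N _ /(_ N (leqnn N))] /=.
rewrite qf qg -surjective_pairing.
by have [] := p_ (k (l N)).
Qed.

(** * The compact-open topology *)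

(** If [f] maps the compact set [K] into the open set [O], continuity of [f]
    and regularity of [C] give each point of [K] a basic neighbourhood [b] with
    [f] mapping [closure b] into some basic [v] inside [O].  Finitely many of
    the [b] cover [K], so finitely many conditions of the form [closure b] into
    [v] force a map to send [K] into [O]. *)
Lemma second_countable_compact_open {C X : topologicalType}
    (A : set {compact-open, C -> X}) :
  compact [set: C] -> hausdorff_space C ->
  @second_countable C -> @second_countable X ->
  (forall f : C -> X, A f -> continuous f) -> @second_countable (set_type A).
Proof.
move=> Ccpt Ch [B Bc [Bo Bb]] [V Vc [Vo Vb]] Acont.
have cptK (K : set C) : closed K -> compact K.
  by move=> Kcl; exact: subclosed_compact Kcl Ccpt (@subsetT _ K).
pose box (bv : set C * set X) : set (set_type A) :=
  [set f | (\val f : C -> X) @` closure bv.1 `<=` bv.2].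
apply: (@second_countable_subbase _ (box @` (B `*` V))).
- by apply: card_le_trans (card_image_le _ _) _; exact: countableX.
- move=> _ [[b v] [/= _ Vv] <-].
  exists [set g : {compact-open, C -> X} | g @` closure b `<=` v] => //.
  by apply: compact_open_open; [apply: cptK; exact: closed_closure|exact: Vo].
move=> F f FF Ff; apply: cvg_initial; apply/compact_open_cvgP => K O Kcpt Oo fKO.
have fc : continuous (\val f : C -> X) by apply: Acont; exact: set_valP.
suff : \forall g \near F, K `<=` [set t | O ((\val g : C -> X) t)].
  by apply: filterS => g KO _ [t Kt <-]; exact: KO.
apply: (compact_near_coveringP K).1 => // t Kt.
have [v [Vv vft] vO] : filter_from [set U | V U /\ U ((\val f : C -> X) t)] id O.
  by apply: Vb; apply: open_nbhs_nbhs; split=> //; apply: fKO; exists t.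
have fvt : nbhs t ((\val f : C -> X) @^-1` v).
  by apply: fc; apply: open_nbhs_nbhs; split=> //; exact: Vo.
(* Regularity leaves room for the closure of b inside the preimage of v. *)
have [W Wt Wv] := compact_regular Ch Ccpt filterT fvt.
have [b [Bb' bt] bW] := Bb t W Wt.
have Fbox : F (box (b, v)).
  apply: Ff; first by exists (b, v).
  by move=> _ [s bs <-]; apply/Wv/(closure_subset bW).
exists (b, box (b, v)); first by split=> //; apply: open_nbhs_nbhs; split=> //; exact: Bo.
by move=> [s g] /= [bs gv]; apply/vO/gv; exists s => //; exact: subset_closure.
Qed.

Lemma unit_interval_compact (R : realType) : compact [set: unit_interval R].
Proof.
have -> : [set: unit_interval R] = clamp @` `[0, 1]%classic.
  apply/seteqP; split=> // s _; exists (ui_val s); last exact: clampK.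
  by rewrite /= in_itv /= ui_ge0 ui_le1.
apply: continuous_compact; last exact: segment_compact.
exact: continuous_subspaceT clamp_continuous.
Qed.

Lemma cube_compact (R : realType) (n : nat) : compact [set: cube R n].
Proof.
have := @tychonoff 'I_n (fun=> unit_interval R) (fun=> setT)
  (fun=> @unit_interval_compact R).
by congr compact; apply/seteqP; split.
Qed.

Lemma cube_hausdorff (R : realType) (n : nat) : hausdorff_space (cube R n).
Proof.
apply: (@hausdorff_continuous_inj (cube R n) 'I_n (fun=> R) (fun j t => ui_val (t j))).
- by move=> _; exact: Rhausdorff.
- move=> j; apply: (@comp_continuous _ _ _ (fun t : cube R n => t j) ui_val).
    exact: Defs.coord_continuous.
  exact: ui_val_continuous.
- by move=> s t st; apply/funext => j; exact/ui_inj/st.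
Qed.

Lemma cube_second_countable (R : realType) (n : nat) : @second_countable (cube R n).
Proof.
apply: (@second_countable_prod 'I_n (fun=> unit_interval R)) => [|_]; first exact: countableP.
exact/second_countable_set_type/second_countable_real.
Qed.

(** * Continuity of the operations on loops *)

Lemma loop_space_second_countable {R : realType} {n : nat} {X : topologicalType} {x : X} :
  @second_countable X -> @second_countable (loop_space R n x).
Proof.
move=> Xc; apply: second_countable_compact_open => //.
- exact: cube_compact.
- exact: cube_hausdorff.
- exact: cube_second_countable.
- by move=> f [].
Qed.

Lemma to_loop_space_continuous {R : realType} {n : nat} {X : topologicalType} {x : X}
    {T : topologicalType} (p : T -> loop_space R n x) :
  (forall a (K : set (cube R n)) (O : set X), compact K -> open O ->
    loop_fun (p a) @` K `<=` O -> \forall b \near a, loop_fun (p b) @` K `<=` O) ->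
  continuous p.
Proof.
move=> pK a; apply: cvg_initial; apply/compact_open_cvgP; exact: pK.
Qed.

Lemma loop_near {R : realType} {n : nat} {X : topologicalType} {x : X}
    {f : loop_space R n x} {K : set (cube R n)} {O : set X} :
  compact K -> open O -> loop_fun f @` K `<=` O ->
  \forall g \near f, loop_fun g @` K `<=` O.
Proof.
move=> Kcpt Oo fKO; apply: open_nbhs_nbhs; split=> //.
exists [set g : {compact-open, cube R n -> X} | g @` K `<=` O] => //.
exact: compact_open_open.
Qed.

Lemma continuous_loop_map {R : realType} {n : nat} {X Y : topologicalType}
    {x : X} {y : Y} (h : pointed_map x y) :
  continuous (loop_map h : loop_space R n x -> loop_space R n y).
Proof.
apply: to_loop_space_continuous => f K O Kcpt Oo fKO.
have hO : open (h @^-1` O) by apply: open_comp => // a _; exact: pointed_map_continuous.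
have fKhO : loop_fun f @` K `<=` h @^-1` O.
  by move=> _ [t Kt <-]; apply: fKO; exists t.
apply: filterS (loop_near Kcpt hO fKhO) => g gK _ [t Kt <-].
by apply: gK; exists t.
Qed.

Section LoopOperationsContinuity.
Context {R : realType} {n : nat} {X : topologicalType} {x : X}.
Local Notation loop := (loop_space R n.+1 x).

(** Inverse and product of loops are made of precompositions [g \o r]; a
    precomposition is continuous because [r] maps [K] to a compact set. *)
Lemma loop_near_reparam (f : loop) (r : cube R n.+1 -> cube R n.+1)
    (K : set (cube R n.+1)) (O : set X) :
  continuous r -> compact K -> open O -> (forall t, K t -> O (loop_fun f (r t))) ->
  \forall g \near f, forall t, K t -> O (loop_fun g (r t)).
Proof.
move=> rc Kcpt Oo fO.
have rK : compact (r @` K).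
  by apply: continuous_compact => //; exact: continuous_subspaceT.
have frK : loop_fun f @` (r @` K) `<=` O.
  by move=> _ [_ [t Kt <-] <-]; exact: fO.
apply: filterS (loop_near rK Oo frK) => g gK t Kt.
by apply: gK; exists (r t) => //; exists t.
Qed.

Lemma continuous_loop_inv : continuous (@loop_inv R n X x).
Proof.
apply: to_loop_space_continuous => f K O Kcpt Oo fKO.
pose r (t : cube R n.+1) := set_first t (clamp (1 - ui_val (t ord0))).
have rc : continuous r.
  apply: reparam_continuous; first exact: idfun_continuous.
  exact: onem_continuous (first_continuous idfun_continuous).
have frO t : K t -> O (loop_fun f (r t)) by move=> Kt; apply: fKO; exists t.
apply: filterS (loop_near_reparam rc Kcpt Oo frO) => g gK _ [t Kt <-].
exact: gK.
Qed.

(** The two halves of the cube on which the product follows [f] and [g] are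
    closed, so each meets [K] in a compact set and is handled separately. *)
Lemma continuous_loop_mul : continuous (fun fg : loop * loop => loop_mul fg.1 fg.2).
Proof.
apply: to_loop_space_continuous => -[f g] K O Kcpt Oo fgKO.
pose coord0 (t : cube R n.+1) := ui_val (t ord0).
have fc : continuous coord0.
  exact: first_continuous idfun_continuous.
pose r1 (t : cube R n.+1) := set_first t (clamp (2 * ui_val (t ord0))).
pose r2 (t : cube R n.+1) := set_first t (clamp (2 * ui_val (t ord0) - 1)).
have r1c : continuous r1.
  by apply: reparam_continuous; [exact: idfun_continuous|exact: double_continuous].
have r2c : continuous r2.
  by apply: reparam_continuous; [exact: idfun_continuous|exact: double1_continuous].
pose K1 := K `&` coord0 @^-1` [set r | r <= 1 / 2].
pose K2 := K `&` coord0 @^-1` [set r | 1 / 2 <= r].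
have K1cpt : compact K1.
  by apply: compact_closedI => //; apply: preimage_closed => //; exact: closed_le.
have K2cpt : compact K2.
  by apply: compact_closedI => //; apply: preimage_closed => //; exact: closed_ge.
have fgE (f' g' : loop) t : loop_fun (loop_mul f' g') t =
    if coord0 t <= 1 / 2 then loop_fun f' (r1 t) else loop_fun g' (r2 t).
  by [].
have fgO t : K t -> O (loop_fun (loop_mul f g) t) by move=> Kt; apply: fgKO; exists t.
have fO t : K1 t -> O (loop_fun f (r1 t)).
  by move=> [/fgO + /= t12]; rewrite fgE t12.
have gO t : K2 t -> O (loop_fun g (r2 t)).
  move=> [Kt /= t12]; have := fgO t Kt; rewrite fgE.
  case: ifP => // t12'.
  (* Where the halves meet, f and g are both evaluated on the boundary. *)
  have {t12'}t12 : ui_val (t ord0) = 1 / 2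
    by apply/eqP; rewrite eq_le t12' t12.
  rewrite !loop_boundary //; apply: set_first_boundary; rewrite t12.
    by left; rewrite clamp_le0 //; lra.
  by right; rewrite clamp_ge1 //; lra.
exists ([set f' | forall t, K1 t -> O (loop_fun f' (r1 t))],
        [set g' | forall t, K2 t -> O (loop_fun g' (r2 t))]).
  by split; [exact: loop_near_reparam fO|exact: loop_near_reparam gO].
move=> [f' g'] /= [f'O g'O] _ [t Kt <-]; rewrite fgE.
by case: leP => t12; [exact: f'O|apply: g'O; split=> //; exact: ltW].
Qed.

End LoopOperationsContinuity.

(** * Topology of the homotopy groups *)

Lemma homotopy_class_quotient {R : realType} {n : nat} {X : topologicalType} (x : X) :
  quotient_map (@homotopy_class R n X x).
Proof. by split=> // a; exists (repr a); exact: homotopy_classK. Qed.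

Lemma pi_map_continuous {R : realType} {n : nat} {X Y : topologicalType} {x : X} {y : Y}
    (h : pointed_map x y) :
  continuous (pi_map h : homotopy_group R n x -> homotopy_group R n y).
Proof.
apply: quotient_map_factor (homotopy_class_quotient x) _.
rewrite (_ : _ \o _ = @homotopy_class R n Y y \o loop_map h).
  move=> f; apply: continuous_comp; first exact: continuous_loop_map.
  exact: quotient_map_continuous (homotopy_class_quotient y) _.
by apply/funext => f /=; exact: pi_mapE.
Qed.

Lemma homotopy_group_inv_continuous {R : realType} {n : nat} {X : topologicalType} (x : X) :
  continuous (fun a : homotopy_group R n.+1 x => (a^-1)%g).
Proof.
apply: quotient_map_factor (homotopy_class_quotient x) _.
rewrite (_ : _ \o _ = @homotopy_class R n.+1 X x \o loop_inv).
  move=> f; apply: continuous_comp; first exact: continuous_loop_inv.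
  exact: quotient_map_continuous (homotopy_class_quotient x) _.
by apply/funext => f /=; exact: pi_invE.
Qed.

Lemma homotopy_group_mul_continuous {R : realType} {n : nat} {X : topologicalType} (x : X) :
  @second_countable X -> @second_countable (homotopy_group R n.+1 x) ->
  hausdorff_space (homotopy_group R n.+1 x) ->
  continuous (fun ab : homotopy_group R n.+1 x * homotopy_group R n.+1 x =>
    (ab.1 * ab.2)%g).
Proof.
move=> Xc pc ph; apply/continuousP => U Uo.
have Lc : @second_countable (loop_space R n.+1 x) by exact: loop_space_second_countable.
apply: (quotient_map_prod (homotopy_class_quotient x) (homotopy_class_quotient x)) => //.
rewrite (_ : [set _ | _] = (fun fg => loop_mul fg.1 fg.2) @^-1`
    (@homotopy_class R n.+1 X x @^-1` U)); last first.
  by apply/funext => fg /=; rewrite -homotopy_classM.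
apply: open_comp => [fg _|]; first exact: continuous_loop_mul.
by apply/(homotopy_class_quotient x).2.
Qed.

Lemma space_limit_second_countable (d : Order.disp_t) (I : porderType d)
    (S : pointed_inverse_system I) :
  countable [set: I] -> (forall i, @second_countable (system_space S i)) ->
  @second_countable (space_limit S).
Proof. by move=> Ic Xc; apply/second_countable_set_type/second_countable_prod. Qed.

Theorem corollary2p12 (R : realType) (n : nat)
    (d : Order.disp_t) (I : porderType d) (S : pointed_inverse_system I)
    (I_countable : countable [set: I])
    (space_second_countable : forall i, @second_countable (system_space S i))
    (pi_hausdorff : forall i,
      hausdorff_space (homotopy_group R n.+1 (system_point S i)))
    (pi_limit_second_countable :
      @second_countable (homotopy_group R n.+1 (limit_base S)))
    (beta_mono : is_group_monomorphism (beta R n S)) :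
  is_topological_group (homotopy_group R n.+1 (limit_base S)).
Proof.
have [_ beta_inj] := beta_mono.
have limit_hausdorff : hausdorff_space (homotopy_group R n.+1 (limit_base S)).
  apply: (@hausdorff_continuous_inj _ I
    (fun i => homotopy_group R n.+1 (system_point S i))
    (fun i => pi_map (projection S i))).
  - exact: pi_hausdorff.
  - by move=> i; exact: pi_map_continuous.
  - by move=> a b ab; apply/beta_inj/limit_eqP.
split; last exact: homotopy_group_inv_continuous.
apply: homotopy_group_mul_continuous => //.
exact: space_limit_second_countable.
Qed.
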